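(* Let $n\le 7$ and let $T\in M_n(\mathbb{C})$. If $T$ is unitarily equivalent to its transpose $T^t$, then $T$ is unitarily equivalent to a complex symmetric matrix.
   Context: Two matrices $A,B\in M_n(\mathbb{C})$ are unitarily equivalent if $A=UBU^*$ for some unitary $U\in M_n(\mathbb{C})$. A complex symmetric matrix is a complex square matrix $S$ with $S=S^t$, where $S^t$ is the (non-conjugated) transpose. *)

(* Defs.v *)
From HB Require Import structures.
From mathcomp Require Import all_boot all_order all_algebra.
From mathcomp Require Import complex.
From mathcomp Require Import reals.

Set Implicit Arguments.
Unset Strict Implicit.
Unset Printing Implicit Defensive.

Import Order.TTheory GRing.Theory Num.Theory.
Local Open Scope ring_scope.
Local Open Scope sesquilinear_scope.

(* [U ^t*] is the conjugate transpose and [U \is unitarymx] says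
   [U *m U ^t* = 1%:M], which for square [U] is two-sided unitarity. *)
Definition unitarily_equivalent (C : numClosedFieldType) (n : nat)
    (A B : 'M[C]_n) : Prop :=
  exists2 U : 'M[C]_n, U \is unitarymx & A = U *m B *m U ^t*.

(* No conjugation: [S^T] is the plain transpose. *)
Definition complex_symmetric (C : numClosedFieldType) (n : nat)
    (S : 'M[C]_n) : Prop :=
  S = S^T.

(* Main.v *)
(** A symmetric unitary V factors as R R^T, so T is unitarily equivalent to a
    complex symmetric matrix as soon as T V = V T^T for some symmetric unitary V.
    From T U = U T^T with U unitary, W = U conj(U) commutes with T. Away from the
    eigenvalue -1 of W, the unitary U becomes symmetric after multiplication by a
    function of W. On the eigenspace of -1, x |-> U conj(x) is a quaternionic
    structure commuting with the Hermitian matrices A = Re T and B = Im T. In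
    dimension at most 7 these are quaternionic Hermitian matrices of size at most
    3: diagonalize A, then multiply the three basis vectors by unit quaternions to
    make the three off-diagonal entries of B complex. So T splits there as
    N (+) N^T, and exchanging the two summands gives V. *)
Require Import Defs.
From mathcomp Require Import all_boot all_order all_algebra.
From mathcomp Require Import complex.
From mathcomp Require Import reals.
From mathcomp Require Import ring zify.
Set Implicit Arguments.
Unset Strict Implicit.
Unset Printing Implicit Defensive.

Import Order.TTheory GRing.Theory Num.Theory.
Local Open Scope ring_scope.
Local Open Scope sesquilinear_scope.

Local Notation "M ^c" := (map_mx Num.conj M) : ring_scope.

(** * Spectral calculus and symmetric unitary matrices *)

Definition conjT := (@trmx_mul, @map_mxM, @map_trmx, @trmxK, @map_mxCK).

(** A nonzero entry of [X] forces the matching entries of [d] and [e] to agree; this is how an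
    intertwining relation passes to functions of the diagonal entries. *)
Lemma diag_mx_intertwine (R : comPzRingType) m n (d : 'rV[R]_m) (e : 'rV[R]_n)
    (X : 'M[R]_(m, n)) :
  diag_mx d *m X = X *m diag_mx e <->
  forall i j, d 0 i * X i j = X i j * e 0 j.
Proof.
rewrite mul_diag_mx mul_mx_diag; split=> [/matrixP E i j|E].
  by have := E i j; rewrite !mxE.
by apply/matrixP=> i j; rewrite !mxE E.
Qed.

Lemma unitary_spectral (C : numClosedFieldType) n (W : 'M[C]_n) :
  W \is unitarymx ->
  exists P : 'M[C]_n, exists d : 'rV[C]_n,
    [/\ P \is unitarymx, W = P^t* *m diag_mx d *m P &
        forall i, d 0 i * (d 0 i)^* = 1].
Proof.
move=> uW; have nW : W \is normalmx.
  by apply/normalmxP; rewrite (unitarymxP uW) (mulmx1C (unitarymxP uW)).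
have uP := spectral_unitarymx W; have WE := orthomx_spectralP nW.
rewrite (invmx_unitary uP) in WE.
exists (spectralmx W), (spectral_diag W); split=> //.
move: uP WE; set P := spectralmx W; set d := spectral_diag W => uP WE i.
have PP := unitarymxP uP.
have : diag_mx d *m (diag_mx d)^t* = 1%:M.
  have -> : diag_mx d = P *m W *m P^t*.
    by rewrite WE !mulmxA PP mul1mx -mulmxA PP mulmx1.
  rewrite !conjT !mulmxA -[_ *m P^t* *m P]mulmxA (mulmx1C PP) mulmx1.
  by rewrite -[_ *m W *m _]mulmxA (unitarymxP uW) mulmx1.
move=> /matrixP/(_ i i); rewrite tr_diag_mx map_diag_mx mulmx_diag.
by rewrite !mxE eqxx.
Qed.

Lemma sqrtC_unimodular (C : numClosedFieldType) (d : C) :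
  d * d^* = 1 -> sqrtC d * (sqrtC d)^* = 1.
Proof.
move=> dd; rewrite -normCK -normrX sqrtCK; apply/eqP.
by rewrite -sqrp_eq1 ?normr_ge0// normCK dd.
Qed.

(** [R] is a square root of [V] given by the spectral calculus. As a function of [V] it inherits the
    symmetry, so [R *m R^T] is its square. *)
Lemma unitary_takagi (C : numClosedFieldType) n (V : 'M[C]_n) :
  V \is unitarymx -> V^T = V ->
  exists2 R : 'M[C]_n, R \is unitarymx & V = R *m R^T.
Proof.
move=> uV sV; have [P [d [uP VE dd]]] := unitary_spectral uV.
have PP := unitarymxP uP; have PP' := mulmx1C PP.
have cPP : P^c *m P^T = 1%:M by rewrite -[P^T]map_mxCK -map_mxM PP map_mx1.
have cPP' : P^T *m P^c = 1%:M by rewrite -[P^T]map_mxCK -map_mxM PP' map_mx1.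
(* Symmetry of [V] read in its eigenbasis: [P *m P^T] links only equal eigenvalues, so it also
   commutes with their square roots. *)
have comd : diag_mx d *m (P *m P^T) = P *m P^T *m diag_mx d.
  have := sV; rewrite VE !conjT tr_diag_mx => /(congr1 (fun X => P *m X *m P^T)).
  by rewrite !mulmxA PP mul1mx -3!mulmxA cPP mulmx1 !mulmxA => <-.
pose r := map_mx sqrtC d.
have comr : diag_mx r *m (P *m P^T) = P *m P^T *m diag_mx r.
  apply/diag_mx_intertwine=> i j; have [->|G0] := eqVneq ((P *m P^T) i j) 0.
    by rewrite mulr0 mul0r.
  have /(_ i j) := (diag_mx_intertwine _ _ _).1 comd.
  by rewrite [RHS]mulrC => /(mulIf G0) E; rewrite mulrC !(mxE map_mx_key) E.
set R := P^t* *m diag_mx r *m P.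
have RT : R^T = R.
  rewrite /R !conjT tr_diag_mx -[LHS]mul1mx -PP' -[RHS]mulmx1 -cPP'.
  by rewrite !mulmxA -[_ *m diag_mx r *m P^c]mulmxA -!mulmxA; congr (_ *m _);
     rewrite !mulmxA -comr !mulmxA.
exists R.
  apply/unitarymxP; rewrite /R !conjT tr_diag_mx map_diag_mx !mulmxA.
  rewrite -[_ *m P *m P^t*]mulmxA PP mulmx1 -[_ *m diag_mx r *m _]mulmxA.
  rewrite mulmx_diag (_ : \row_j _ = const_mx 1) ?diag_const_mx ?mulmx1 //.
  by apply/rowP=> j; rewrite !mxE sqrtC_unimodular.
rewrite RT VE /R !mulmxA -[_ *m P *m P^t*]mulmxA PP mulmx1.
rewrite -[_ *m diag_mx r *m diag_mx r]mulmxA mulmx_diag; congr (_ *m diag_mx _ *m _).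
by apply/rowP=> j; rewrite !mxE -expr2 sqrtCK.
Qed.

(** The map [x |-> V conj(x)] is then a conjugation, an antilinear isometric involution, and [T] is
    complex symmetric with respect to it. *)
Definition symmetrizable (C : numClosedFieldType) n (T : 'M[C]_n) : Prop :=
  exists V : 'M[C]_n, [/\ V \is unitarymx, V^T = V & T *m V = V *m T^T].

(** Once [V] is written as [R *m R^T], conjugation by [R] turns [T V = V T^T] into the symmetry of
    [R^t* T R]. *)
Lemma symmetrizable_UECSM (C : numClosedFieldType) n (T : 'M[C]_n) :
  symmetrizable T ->
  exists2 S : 'M[C]_n, complex_symmetric S & unitarily_equivalent T S.
Proof.
case=> V [uV sV TV]; have [R uR VE] := unitary_takagi uV sV.
have RR := unitarymxP uR; have RR' := mulmx1C RR.
have cRR : R^T *m R^c = 1%:M by rewrite -[R^T]map_mxCK -map_mxM RR' map_mx1.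
exists (R^t* *m T *m R); last first.
  by exists R => //; rewrite !mulmxA RR mul1mx -mulmxA RR mulmx1.
rewrite /complex_symmetric !conjT -[X in _ = X]mul1mx -RR' !mulmxA.
rewrite -[_ *m R *m R^T]mulmxA -VE -[_ *m V *m T^T]mulmxA -TV VE !mulmxA.
by rewrite -[_ *m R^T *m _]mulmxA cRR mulmx1.
Qed.

(** * Unit quaternions and isotropic pairs *)

(** The pair of [p] and [q] encodes the quaternion [p + q j], split here into a real factor and a
    unit quaternion. *)
Lemma unit_pair_scale (C : numClosedFieldType) (p q : C) :
  exists r p' q', [/\ r^* = r, p = r * p', q = r * q' & p' * p'^* + q' * q'^* = 1].
Proof.
set s := p * p^* + q * q^*.
have s_ge0 : 0 <= s by rewrite addr_ge0// mul_conjC_ge0.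
have [s0|sN0] := eqVneq s 0.
  (* The zero quaternion gets the factor 0 and an arbitrary unit. *)
  exists 0, 1, 0; rewrite !mul0r rmorph0 rmorph1 mulr1 addr0.
  have := s0 => /eqP; rewrite paddr_eq0 ?mul_conjC_ge0// !mul_conjC_eq0.
  by case/andP=> /eqP-> /eqP->.
have r0 : sqrtC s != 0 by rewrite sqrtC_eq0.
exists (sqrtC s), (p / sqrtC s), (q / sqrtC s).
have sr : (sqrtC s)^* = sqrtC s by apply/CrealP; rewrite ger0_real ?sqrtC_ge0.
split; [by []|by rewrite mulrC divfK|by rewrite mulrC divfK|].
rewrite !rmorphM/= !fmorphV/= sr.
have -> : p / sqrtC s * (p^* / sqrtC s) + q / sqrtC s * (q^* / sqrtC s) =
  s / (sqrtC s) ^+ 2 by rewrite /s; field.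
by rewrite sqrtCK divff.
Qed.

(** Setting [x = 1] leaves a quadratic in [y] when [c] is nonzero; otherwise [x = 0], [y = 1] is a
    zero. By homogeneity the zero can be normalized. *)
Lemma isotropic_unit_pair (C : numClosedFieldType) (a b c : C) :
  exists x y, a * x ^+ 2 + b * x * y + c * y ^+ 2 = 0 /\
              x * x^* + y * y^* = 1.
Proof.
have [x [y [E nz]]] : exists x y,
    a * x ^+ 2 + b * x * y + c * y ^+ 2 = 0 /\ (x != 0) || (y != 0).
  have [->|c0] := eqVneq c 0.
    by exists 0, 1; rewrite oner_neq0 orbT; split=> //; ring.
  have [y yE] := @solve_monicpoly C 2
    (fun i => if i == 0%N then - a / c else - b / c) isT.
  exists 1, y; rewrite oner_neq0; split=> //; rewrite yE !big_ord_recl big_ord0/=.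
  by field.
have [r [x' [y' [_ xE yE n1]]]] := unit_pair_scale x y.
exists x', y'; split=> //.
have r0 : r != 0 by apply: contraTneq nz => r0; rewrite xE yE r0 !mul0r eqxx.
apply: (mulfI (expf_neq0 2 r0)); rewrite mulr0 -[RHS]E xE yE; ring.
Qed.

(* The equations for the pairs (0,1) and (0,2) determine the phases of rows 1 and
   2 from the phase (x, y) of row 0; the equation for (1,2) then becomes the
   vanishing of a binary quadratic form at (x, y). *)
Lemma quaternion_gauge (C : numClosedFieldType) k (p q : 'M[C]_k) :
  (k <= 3)%N -> p^T = - p -> q^t* = q ->
  exists al be : 'I_k -> C, (forall i, al i * (al i)^* + be i * (be i)^* = 1) /\
    forall i j, al i * p i j * al j + al i * q i j * be j
              - be i * q j i * al j + be i * (p i j)^* * be j = 0.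
Proof.
move=> k3 pT qT.
have pE i j : p j i = - p i j by have /matrixP/(_ i j) := pT; rewrite !mxE.
have qE i j : (q j i)^* = q i j by have /matrixP/(_ i j) := qT; rewrite !mxE.
case: k => [|k] in p q k3 pT qT pE qE *.
  by exists (fun=> 0), (fun=> 0); split; case.
(* When the size is below 3, [inord] sends the missing indices to 0; the extra constraint this puts
   on [x] and [y] is harmless. *)
pose o i : 'I_k.+1 := inord i.
have [r1 [p1 [q1 [r1R p1E q1E n1]]]] :=
  unit_pair_scale (p (o 0%N) (o 1%N)) (q (o 0%N) (o 1%N)).
have [r2 [p2 [q2 [r2R p2E q2E n2]]]] :=
  unit_pair_scale (p (o 0%N) (o 2%N)) (q (o 0%N) (o 2%N)).
pose P := p (o 1%N) (o 2%N); pose Q := q (o 1%N) (o 2%N).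
(* Coefficients of the equation for (1,2) after rows 1 and 2 are expressed through [x] and [y]. *)
pose a := P * q1 * q2 - Q * q1 * p2 + Q^* * p1 * q2 + P^* * p1 * p2.
pose b := P * (q1 * p2^* + p1^* * q2) - Q * (p1^* * p2 - q1 * q2^*)
  + Q^* * (p1 * p2^* - q1^* * q2) - P^* * (p1 * q2^* + q1^* * p2).
pose c := P * p1^* * p2^* + Q * p1^* * q2^* - Q^* * q1^* * p2^*
  + P^* * q1^* * q2^*.
have [x [y [xy0 n0]]] := isotropic_unit_pair a b c.
(* The equation for (0,1) is linear in row 1, with coefficients [x p1 - y q1^*] and [x q1 + y p1^*]
   up to the factor [r1]. Swapping them with one sign change solves it; row 2 is alike. *)
pose al i := [:: x; - (x * q1 + y * p1^*); - (x * q2 + y * p2^*)]`_i.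
pose be i := [:: y; x * p1 - y * q1^*; x * p2 - y * q2^*]`_i.
exists (fun i => al (val i)), (fun i => be (val i)); split=> [i|].
  have : (val i < 3)%N by rewrite (leq_trans (ltn_ord i)).
  (* Multiplicativity of the quaternion norm. *)
  have nE s t : s * s^* + t * t^* = 1 ->
      - (x * t + y * s^*) * (- (x * t + y * s^*))^*
      + (x * s - y * t^*) * (x * s - y * t^*)^* = 1.
    move=> st; rewrite rmorphN rmorphB rmorphD !rmorphM/= !conjCK.
    transitivity ((x * x^* + y * y^*) * (s * s^* + t * t^*)); first by ring.
    by rewrite n0 st mulr1.
  by case: (val i) => [|[|[|]]] //= _; rewrite ?nE.
pose B (i j : 'I_k.+1) := al i * p i j * al j + al i * q i j * be j
  - be i * q j i * al j + be i * (p i j)^* * be j.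
pose B' s t := al s * p (o s) (o t) * al t + al s * q (o s) (o t) * be t
  - be s * (q (o s) (o t))^* * al t + be s * (p (o s) (o t))^* * be t.
(* [B] is antisymmetric, so the entries above the diagonal suffice. *)
suff Blt (i j : 'I_k.+1) : (i < j)%N -> B i j = 0.
  move=> i j; have [/Blt//|lt_ji|/val_inj->] := ltngtP i j.
    rewrite -[RHS]oppr0 -(Blt j i lt_ji) /B (pE i j) rmorphN; ring.
  have -> : p j j = 0.
    by apply/eqP; have /eqP := pE j j; rewrite -addr_eq0 -mulr2n mulrn_eq0.
  by rewrite rmorph0; ring.
have j3 : (j < 3)%N by rewrite (leq_trans (ltn_ord j)).
have -> : B i j = B' i j by rewrite /B' /o !inord_val qE.
move: (nat_of_ord i) (nat_of_ord j) j3 => [|[|s]] [|[|[|t]]] //= _ _; rewrite /B'.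
- by rewrite p1E q1E /al /be /= !rmorphM/= r1R; ring.
- by rewrite p2E q2E /al /be /= !rmorphM/= r2R; ring.
rewrite -[RHS]xy0 -/P -/Q /al /be /a /b /c /=.
ring.
Qed.

Lemma unitary_complement (C : numClosedFieldType) m n (G : 'M[C]_(m, n)) :
  G \is unitarymx ->
  exists k, exists Y : 'M[C]_(k, n),
    [/\ (m + k = n)%N, Y \is unitarymx, Y *m G^t* = 0 &
        G^t* *m G + Y^t* *m Y = 1%:M].
Proof.
move=> uG; pose K := orthomx Num.conj (mx_of_hermitian (hermitian1mx n)) G.
exists (\rank K), (schmidt (row_base K)).
have uY : schmidt (row_base K) \is unitarymx.
  by rewrite schmidt_unitarymx ?rank_leq_col.
have YG : schmidt (row_base K) *m G^t* = 0.
  by apply/orthomx1P; rewrite eqmx_schmidt_free ?row_base_free// eq_row_base.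
have mk : (m + \rank K = n)%N by rewrite -(mxrank_unitary uG) add_rank_ortho.
split=> //; move: uY YG; set Y := schmidt _ => uY YG.
have uGY : col_mx G Y \is unitarymx.
  apply/unitarymxP; rewrite tr_col_mx map_row_mx mul_col_row YG.
  rewrite (unitarymxP uG) (unitarymxP uY) (_ : G *m Y^t* = 0) -?scalar_mx_block//.
  by rewrite -[G]trmxCK -map_mxM -trmx_mul YG trmx0 map_mx0.
have := mulmxKtV (1%:M : 'M[C]_n) uGY mk.
by rewrite mul1mx tr_col_mx map_row_mx mul_row_col.
Qed.

Lemma hermitian_eigenrow (C : numClosedFieldType) n (A : 'M[C]_n) :
  (0 < n)%N -> A^t* = A ->
  exists a : C, exists x : 'rV[C]_n,
    [/\ a^* = a, x \is unitarymx & x *m A = a *: x].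
Proof.
case: n => // n in A * => _ hA.
have nA : A \is normalmx by apply/normalmxP; rewrite hA.
have uP := spectral_unitarymx A; have := orthomx_spectralP nA.
rewrite (invmx_unitary uP); move: uP.
set P := spectralmx A; set d := spectral_diag A => uP AE.
have uR : row 0 P \is unitarymx.
  apply/unitarymxP/matrixP=> i j; rewrite !ord1 -dotmxE.
  by rewrite (row_unitarymxP uP) mxE.
have xA : row 0 P *m A = d 0 0 *: row 0 P.
  rewrite AE -row_mul !mulmxA (unitarymxP uP) mul1mx row_mul row_diag_mx.
  by rewrite -scalemxAl -rowE.
exists (d 0 0), (row 0 P); split=> //.
have dE : (d 0 0)%:M = row 0 P *m A *m (row 0 P)^t*.
  by rewrite xA -scalemxAl (unitarymxP uR) scalemx1.
have : ((d 0 0)%:M : 'M[C]_1)^t* = (d 0 0)%:M.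
  by rewrite dE !conjT hA mulmxA.
by rewrite tr_scalar_mx map_scalar_mx => /matrixP/(_ 0 0); rewrite !mxE.
Qed.

(* If E is the projection onto the row space of F, then E commutes with T and
   U E^T = (1 - E) U, so that (1 - 2 E) U is symmetric although U is not. *)
Lemma isotropic_symmetrizable (C : numClosedFieldType) k n (T U : 'M[C]_n)
    (F : 'M[C]_(k, n)) :
  U \is unitarymx -> U^T = - U -> T *m U = U *m T^T -> F \is unitarymx ->
  F^t* *m F + U *m F^T *m F^c *m U^t* = 1%:M ->
  F *m T *m U *m F^T = 0 -> F *m T^t* *m U *m F^T = 0 -> symmetrizable T.
Proof.
move=> uU sU TU uF; set E := F^t* *m F => E1 FT FT'.
have UU := unitarymxP uU; have UU' := mulmx1C UU.
have EE : E *m E = E.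
  by rewrite /E mulmxA -[_ *m F *m _]mulmxA (unitarymxP uF) mulmx1.
have hE : E^t* = E by rewrite /E !conjT.
(* The second summand of [E1] is [1 - E]; multiplied by [U] on the right it becomes [U *m E^T]. *)
have UE : U *m E^T = U - E *m U.
  rewrite -[U in U - _]mul1mx -E1 mulmxDl -[_ *m U^t* *m U]mulmxA UU' mulmx1.
  by rewrite addrC addKr /E !conjT mulmxA.
(* The adjoint of the hypothesis says that [1 - E] kills [M *m F^t*], so the range of [E] is
   invariant under [M]. Applied to [T] and to its adjoint, this makes the range reducing. *)
have inv M : F *m M^t* *m U *m F^T = 0 -> M *m E = E *m M *m E.
  move=> FM; rewrite -[LHS]mul1mx -E1 mulmxDl -[E *m (M *m E)]mulmxA.
  have : (F *m M^t* *m U *m F^T)^t* = 0 by rewrite FM trmx0 map_mx0.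
  rewrite !conjT !mulmxA => FM'.
  have -> : U *m F^T *m F^c *m U^t* *m M *m F^t* =
            U *m F^T *m (F^c *m U^t* *m M *m F^t*) by rewrite !mulmxA.
  by rewrite FM' mulmx0 mul0mx addr0.
clearbody E; have TE : T *m E = E *m T.
  rewrite (inv _ FT').
  have := inv (T^t*); rewrite !conjT => /(_ FT) /(congr1 (fun M => M^t*)).
  by rewrite !conjT hE mulmxA.
exists (U - 2 *: (E *m U)); split.
- apply/unitarymxP.
  have -> : U - 2 *: (E *m U) = (1%:M - 2 *: E) *m U.
    by rewrite mulmxBl mul1mx scalemxAl.
  rewrite !conjT !mulmxA -[_ *m U *m _]mulmxA UU mulmx1.
  have -> : (1%:M - 2 *: E)^t* = 1%:M - 2 *: E.
    rewrite -[in RHS]hE; apply/matrixP=> i j.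
    by rewrite !mxE rmorphB rmorphM/= !conjC_nat eq_sym.
  rewrite mulmxBl mul1mx mulmxBr mulmx1 -scalemxAl -scalemxAr EE scalerA.
  apply/matrixP=> i j; rewrite !mxE; ring.
- rewrite linearB/= linearZ/= trmx_mul sU mulNmx UE.
  apply/matrixP=> i j; rewrite !mxE; ring.
- rewrite mulmxBr mulmxBl -scalemxAr -scalemxAl mulmxA TE.
  by rewrite -![_ *m T *m U]mulmxA -mulmxA TU mulmxA.
Qed.

Lemma trmxCZ (C : numClosedFieldType) m n (a : C) (M : 'M[C]_(m, n)) :
  (a *: M)^t* = a^* *: M^t*.
Proof. by apply/matrixP=> i j; rewrite !mxE rmorphM. Qed.

Lemma diag_mx_row_mx (R : nmodType) m n (a : 'rV[R]_m) (b : 'rV[R]_n) :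
  diag_mx (row_mx a b) = block_mx (diag_mx a) 0 0 (diag_mx b).
Proof.
apply/matrixP=> i j; rewrite !mxE; case: splitP => i' ii'; rewrite !mxE;
  case: splitP => j' jj'; rewrite !mxE -val_eqE /= ii' jj' ?val_eqE//.
- by rewrite (_ : (_ == _) = false) //; have := ltn_ord i'; lia.
- by rewrite (_ : (_ == _) = false) //; have := ltn_ord j'; lia.
- by rewrite eqn_add2l.
Qed.

(** Kramers degeneracy: an eigenrow [x] of [A] has the partner [x^c *m U^t*], orthogonal to it and
    with the same eigenvalue because that is real. Both are split off, and [A] and [U] are
    compressed to the complement. [e] keeps one row of each pair; together with the partners it
    resolves the identity. *)
Lemma skew_eigenbasis (C : numClosedFieldType) n (A U : 'M[C]_n) :
  U \is unitarymx -> U^T = - U -> A^t* = A -> A *m U = U *m A^T ->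
  exists k, exists e : 'M[C]_(k, n), exists a : 'rV[C]_k,
    [/\ n = (k + k)%N, e \is unitarymx, e *m U *m e^T = 0,
        e *m A = diag_mx a *m e &
        e^t* *m e + U *m e^T *m e^c *m U^t* = 1%:M].
Proof.
have [N] := ubnP n; elim: N n A U => // N IH n A U nN uU sU hA AU.
case: (posnP n) => [n0|n_gt0].
  move: A U uU sU hA AU; rewrite n0 => A U _ _ _ _.
  exists 0%N, 0, 0; split=> //; try by apply/matrixP=> -[].
  by apply/unitarymxP/matrixP=> -[].
have UU := unitarymxP uU; have UU' := mulmx1C UU.
have Uc : U *m U^c = - 1%:M.
  have UN : U = - U^T by rewrite sU opprK.
  by rewrite {2}UN map_mxN mulmxN UU.
have [a0 [x [a0R ux xA]]] := hermitian_eigenrow n_gt0 hA.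
have xx := unitarymxP ux.
pose f := x^c *m U^t*.
have ff : f *m f^t* = 1%:M.
  rewrite /f !conjT -!mulmxA [U^t* *m _]mulmxA UU' mul1mx.
  by rewrite -[x^T]map_mxCK -map_mxM xx map_mx1.
have fs : f^t* = U *m x^T by rewrite /f !conjT.
(* A skew-symmetric 1 by 1 matrix vanishes, so [x] is orthogonal to its partner. *)
have xUx : x *m U *m x^T = 0.
  have : (x *m U *m x^T)^T = - (x *m U *m x^T).
    by rewrite !conjT sU mulNmx mulmxN mulmxA.
  move=> /matrixP/(_ 0 0); rewrite mxE [RHS]mxE => /eqP.
  rewrite -addr_eq0 -mulr2n mulrn_eq0 /= => /eqP z0.
  by apply/matrixP=> i j; rewrite !ord1 z0 mxE.
have xf : x *m f^t* = 0 by rewrite fs mulmxA.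
have fx : f *m x^t* = 0 by rewrite -[f]trmxCK -map_mxM -trmx_mul xf trmx0 map_mx0.
have UA : U^t* *m A = A^T *m U^t*.
  by rewrite -[LHS]mulmx1 -UU !mulmxA -[_ *m A *m U]mulmxA AU !mulmxA UU' mul1mx.
have fA : f *m A = a0 *: f.
  have AT : A^T = A^c by rewrite -{1}hA map_trmx trmxK.
  by rewrite /f -mulmxA UA mulmxA AT -map_mxM xA map_mxZ/= a0R scalemxAl.
pose G := col_mx x f.
have uG : G \is unitarymx.
  apply/unitarymxP; rewrite tr_col_mx map_row_mx mul_col_row xx ff xf fx.
  by rewrite -scalar_mx_block.
have GA : G *m A = a0 *: G by rewrite mul_col_mx xA fA scale_col_mx.
have [k [Y [kn uY YG GY]]] := unitary_complement uG.
have YY := unitarymxP uY.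
have [Yx Yf] : Y *m x^t* = 0 /\ Y *m f^t* = 0.
  apply/eq_row_mx; rewrite row_mx0 -mul_mx_row -map_row_mx -tr_col_mx.
  exact: YG.
have GYc : G^T *m G^c + Y^T *m Y^c = 1%:M.
  have := congr1 (fun M => M^c) GY; rewrite map_mxD !map_mxM !map_mxCK map_mx1.
  by [].
pose A1 := Y *m A *m Y^t*; pose U1 := Y *m U *m Y^T.
have YA : Y *m A = A1 *m Y.
  have YAG : Y *m A *m G^t* = 0.
    rewrite -mulmxA -[A]trmxCK -map_mxM -trmx_mul hA GA trmxCZ a0R.
    by rewrite -scalemxAr YG scaler0.
  rewrite -[LHS]mulmx1 -GY mulmxDr !mulmxA YAG mul0mx add0r.
  by [].
(* The plane of [x] and [f] is stable under the quaternionic structure, since [U x^T = f^t*] and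
   [U f^T = - x^t*]; hence so is its complement. *)
have YU : Y *m U = U1 *m Y^c.
  have YUG : Y *m U *m G^T = 0.
    rewrite tr_col_mx mul_mx_row -mulmxA -fs Yf /f !conjT -mulmxA.
    rewrite [U *m _]mulmxA Uc mulNmx mul1mx mulmxN Yx oppr0.
    by rewrite row_mx0.
  rewrite -[LHS]mulmx1 -GYc mulmxDr !mulmxA YUG mul0mx add0r.
  by [].
have uU1 : U1 \is unitarymx.
  apply/unitarymxP; rewrite {2}/U1 !conjT !mulmxA -YU.
  by rewrite -[_ *m U *m _]mulmxA UU mulmx1.
have sU1 : U1^T = - U1.
  by rewrite /U1 !conjT sU mulNmx mulmxN mulmxA.
have hA1 : A1^t* = A1 by rewrite /A1 !conjT hA mulmxA.
have AU1 : A1 *m U1 = U1 *m A1^T.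
  rewrite /U1 !mulmxA -YA -[Y *m A *m U]mulmxA AU /A1 !conjT !mulmxA.
  by rewrite {1}YU.
have [|k' [e [a [kE ue eUe eA E1]]]] := IH k A1 U1 _ uU1 sU1 hA1 AU1; first lia.
have ee := unitarymxP ue.
exists (1 + k')%N, (col_mx x (e *m Y)), (row_mx (a0%:M : 'rV_1) a); split.
- lia.
- apply/unitarymxP; rewrite tr_col_mx map_row_mx mul_col_row xx !conjT !mulmxA.
  rewrite -[_ *m Y *m Y^t*]mulmxA YY mulmx1 ee -[e *m Y *m x^t*]mulmxA Yx mulmx0.
  have -> : x *m Y^t* = 0.
    by rewrite -[x]trmxCK -map_mxM -trmx_mul Yx trmx0 map_mx0.
  by rewrite mul0mx -scalar_mx_block.
- have YUx : Y *m U *m x^T = 0 by rewrite -mulmxA -fs.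
  have xUY : x *m U *m Y^T = 0.
    by apply: trmx_inj; rewrite !conjT sU mulNmx mulmxN mulmxA YUx oppr0 trmx0.
  rewrite tr_col_mx mul_col_mx mul_col_row xUx !conjT !mulmxA xUY mul0mx.
  rewrite -[e *m Y *m U]mulmxA -[e *m _ *m x^T]mulmxA YUx mulmx0.
  by rewrite -[e *m _ *m Y^T]mulmxA eUe block_mx0.
- rewrite mul_col_mx diag_mx_row_mx mul_block_col !mul0mx addr0 add0r xA.
  rewrite -mulmxA YA mulmxA eA mulmxA; congr col_mx.
  rewrite -mul_scalar_mx; congr (_ *m _).
  by apply/matrixP=> i j; rewrite !ord1 !mxE.
(* Partners formed with [U1] in the complement are partners for [U] in the whole space. *)
have YcU : Y^c *m U^t* = U1^t* *m Y.
  rewrite -[Y^c]mul1mx -(mulmx1C (unitarymxP uU1)) -[_ *m U1 *m _]mulmxA -YU.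
  by rewrite -!mulmxA UU mulmx1.
have UYT : U *m Y^T = Y^t* *m U1.
  have := congr1 (fun M => M^t*) YcU.
  by rewrite (trmx_mul (Y^c)) (trmx_mul (U1^t*)) !map_mxM !conjT.
rewrite !tr_col_mx !map_row_mx mul_row_col mul_mx_row map_col_mx mul_row_col.
rewrite mulmxDl !trmx_mul !map_mxM -fs !mulmxA UYT -[_ *m e^c *m Y^c]mulmxA.
have -> : Y^t* *m U1 *m e^T *m (e^c *m Y^c) *m U^t* =
    Y^t* *m (U1 *m e^T *m e^c *m U1^t*) *m Y.
  by rewrite !mulmxA -[_ *m Y^c *m U^t*]mulmxA YcU !mulmxA.
rewrite -[f^t* *m x^c *m U^t*]mulmxA -/f addrACA -[Y^t* *m e^t* *m e]mulmxA.
rewrite -mulmxDl -mulmxDr E1 mulmx1 -GY; congr (_ + _).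
by rewrite tr_col_mx map_row_mx mul_row_col.
Qed.

(* A U-isotropic subspace of half the dimension reduces T: the Hermitian part of
   T is diagonal in the basis formed by the rows of e and f, and the
   skew-Hermitian part becomes block diagonal after a quaternionic change of
   phase on each pair of corresponding rows. *)
Lemma skew_symmetrizable (C : numClosedFieldType) n (T U : 'M[C]_n) :
  (n <= 7)%N -> U \is unitarymx -> U^T = - U -> T *m U = U *m T^T ->
  symmetrizable T.
Proof.
move=> n7 uU sU TU.
have UU := unitarymxP uU; have UU' := mulmx1C UU.
have Uc : U *m U^c = - 1%:M.
  have UN : U = - U^T by rewrite sU opprK.
  by rewrite {2}UN map_mxN mulmxN UU.
have TsU : T^t* *m U = U *m T^c.
  have : (T *m U)^t* = (U *m T^T)^t* by rewrite TU.
  rewrite !conjT => /(congr1 (fun M => U *m M *m U)).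
  by rewrite !mulmxA UU mul1mx => ->; rewrite -mulmxA UU' mulmx1.
(* Twice the real part of [T] and minus twice its imaginary part. *)
pose A := T + T^t*; pose B := 'i *: (T - T^t*).
have hA : A^t* = A.
  by apply/matrixP=> i j; rewrite !mxE rmorphD/= conjCK addrC.
have hB : B^t* = B.
  apply/matrixP=> i j; rewrite !mxE rmorphM rmorphB/= conjCK conjCi; ring.
have AU : A *m U = U *m A^T.
  by rewrite mulmxDl TU TsU linearD/= mulmxDr -map_trmx trmxK.
have BU : B *m U = U *m B^T.
  rewrite linearZ/= linearB/= -scalemxAl -scalemxAr mulmxBl mulmxBr TU TsU.
  by rewrite -map_trmx trmxK.
have [k [e [a [kn ue eUe eA E1]]]] := skew_eigenbasis uU sU hA AU.
have ee := unitarymxP ue.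
pose f := e^c *m U^t*.
have UfT : U *m f^T = - e^t* by rewrite /f !conjT mulmxA Uc mulNmx mul1mx.
have fs : f^t* = U *m e^T by rewrite /f !conjT.
have ef : e *m f^t* = 0 by rewrite fs mulmxA.
have fe : f *m e^t* = 0 by rewrite -[f]trmxCK -map_mxM -trmx_mul ef trmx0 map_mx0.
have ff : f *m f^t* = 1%:M.
  rewrite fs /f mulmxA -[_ *m U^t* *m U]mulmxA UU' mulmx1.
  by rewrite -[e^T]map_mxCK -map_mxM ee map_mx1.
have UM (M : 'M[C]_n) : M *m U = U *m M^T -> U^t* *m M = M^T *m U^t*.
  by move=> MU; rewrite -[LHS]mulmx1 -UU !mulmxA -[_ *m M *m U]mulmxA MU !mulmxA
     UU' mul1mx.
have hT (M : 'M[C]_n) : M^t* = M -> M^T = M^c.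
  by move=> hM; rewrite -{1}hM map_trmx trmxK.
pose D := diag_mx a.
have hD : D^c = D.
  have DE : D = e *m A *m e^t* by rewrite eA -mulmxA ee mulmx1.
  have DT : D^T = D by rewrite tr_diag_mx.
  by rewrite -{1}DT DE !conjT hA mulmxA.
have fA : f *m A = D *m f.
  by rewrite /f -mulmxA UM// mulmxA hT// -map_mxM eA map_mxM hD mulmxA.
(* [p], [q], [- q^T] and [p^c] are the four blocks of the bilinear form [B *m U] on the rows of [e]
   and [f]. *)
pose p := e *m B *m U *m e^T; pose q := - (e *m B *m e^t*).
have pT : p^T = - p.
  by rewrite /p !conjT sU mulNmx !mulmxN !mulmxA -[e *m B *m U]mulmxA BU !mulmxA.
have qs : q^t* = q by rewrite /q linearN/= map_mxN !conjT hB mulmxA.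
have fBe : f *m B *m U *m e^T = - q^T.
  rewrite /q linearN/= opprK !conjT /f -[_ *m U^t* *m B]mulmxA UM// !mulmxA.
  by rewrite -[_ *m U^t* *m U]mulmxA UU' mulmx1.
have fBf : f *m B *m U *m f^T = p^c.
  rewrite -mulmxA UfT /f -[_ *m U^t* *m B]mulmxA UM// /p !map_mxM.
  have -> : U^c = - U^t* by rewrite sU map_mxN opprK.
  by rewrite -(hT _ hB) !mulmxN !mulNmx !mulmxA.
have [pE qE] : p = e *m B *m U *m e^T /\ q = - (e *m B *m e^t*) by [].
have E2 : e^t* *m e + f^t* *m f = 1%:M by rewrite fs /f mulmxA.
have fUe : f *m U *m e^T = 1%:M by rewrite -mulmxA -fs.
have [AE BE] : A = T + T^t* /\ B = 'i *: (T - T^t*) by [].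
(* The bound 7 enters here: [n] equals [2k], so [k] is at most 3. *)
clearbody A B f p q; have k3 : (k <= 3)%N by lia.
have [al [be [n1 gauge]]] := quaternion_gauge k3 pT qs.
pose La := diag_mx (\row_i al i); pose Lb := diag_mx (\row_i be i).
have LT : (La^T = La) * (Lb^T = Lb) by rewrite !tr_diag_mx.
have LC (x y : 'I_k -> C) : (diag_mx (\row_i x i))^c *m diag_mx (\row_i y i) =
  diag_mx (\row_i y i) *m (diag_mx (\row_i x i))^c.
  by rewrite map_diag_mx diag_mxC.
have L1 : La *m La^c + Lb *m Lb^c = 1%:M.
  rewrite !map_diag_mx !mulmx_diag; apply/matrixP=> i j; rewrite !mxE.
  by rewrite -mulrnDl n1.
(* Each row of [e] is rotated by a unit quaternion within the plane it spans with its partner. *)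
pose F := La *m e + Lb *m f.
have FT : F^T = e^T *m La + f^T *m Lb.
  by rewrite linearD/= !trmx_mul !LT.
have Fs : F^t* = e^t* *m La^c + f^t* *m Lb^c.
  by rewrite FT map_mxD !map_mxM.
have uF : F \is unitarymx.
  apply/unitarymxP; rewrite Fs /F mulmxDl !mulmxDr !mulmxA.
  rewrite -[La *m e *m e^t*]mulmxA ee mulmx1 -[La *m e *m f^t*]mulmxA ef.
  rewrite -[Lb *m f *m e^t*]mulmxA fe -[Lb *m f *m f^t*]mulmxA ff.
  by rewrite !mulmx0 !mul0mx addr0 add0r mulmx1.
have FBF : F *m B *m U *m F^T = 0.
  rewrite FT /F mulmxDl !mulmxDl !mulmxDr.
  have -> : La *m e *m B *m U *m (e^T *m La) = La *m p *m La.
    by rewrite pE !mulmxA.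
  have -> : Lb *m f *m B *m U *m (f^T *m Lb) = Lb *m p^c *m Lb.
    by rewrite -fBf !mulmxA.
  have -> : Lb *m f *m B *m U *m (e^T *m La) = - (Lb *m q^T *m La).
    by rewrite -mulNmx -mulmxN -fBe !mulmxA.
  have -> : La *m e *m B *m U *m (f^T *m Lb) = La *m q *m Lb.
    by rewrite mulmxA -[La *m e *m B *m U *m _]mulmxA UfT qE !mulmxN -!mulmxA.
  rewrite addrA !(mul_diag_mx, mul_mx_diag); apply/matrixP=> i j; rewrite !mxE.
  exact: gauge.
have FUF : F *m U *m F^T = 0.
  rewrite FT /F !mulmxDl !mulmxDr.
  have -> : La *m e *m U *m (e^T *m La) = 0.
    by rewrite -[0](mul0mx _ La) -[0](mulmx0 _ La) -eUe !mulmxA.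
  have -> : Lb *m f *m U *m (e^T *m La) = Lb *m La.
    by rewrite -[Lb in RHS]mulmx1 -fUe !mulmxA.
  have -> : La *m e *m U *m (f^T *m Lb) = - (La *m Lb).
    rewrite mulmxA -[La *m e *m U *m _]mulmxA UfT mulmxN -mulmxA ee mulmx1.
    by rewrite mulNmx.
  have -> : Lb *m f *m U *m (f^T *m Lb) = 0.
    rewrite mulmxA -[Lb *m f *m U *m _]mulmxA UfT mulmxN -mulmxA fe.
    by rewrite mulmx0 oppr0 mul0mx.
  by rewrite add0r addr0 /La /Lb diag_mxC ?addNr ?subrr.
(* Corresponding rows of [e] and [f] share an eigenvalue, so the rotation leaves [A] diagonal. *)
have FA : F *m A = D *m F.
  rewrite /F mulmxDl mulmxDr -!mulmxA eA fA !mulmxA.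
  by rewrite /La /Lb /D ![diag_mx (\row_i _) *m _]diag_mxC.
have FAF : F *m A *m U *m F^T = 0.
  by rewrite FA -!mulmxA [F *m _]mulmxA FUF mulmx0.
have FE : F = La *m e + Lb *m f by [].
(* [T] and its adjoint are [(A - i B) / 2] and [(A + i B) / 2], so isotropy for [A] and [B] is
   enough. *)
clearbody F; have comb c d : F *m (c *: A + d *: B) *m U *m F^T = 0.
  rewrite mulmxDr !mulmxDl -!scalemxAr -!scalemxAl FAF FBF.
  by rewrite !scaler0 addr0.
have i2 : 'i * 'i = -1 :> C by rewrite -expr2 sqrCi.
apply: (isotropic_symmetrizable uU sU TU uF).
(* The cross terms between [e] and [f] cancel in the sum of the two projections, and the unit norms
   leave [E2]. *)
- have UFT : U *m F^T = f^t* *m La - e^t* *m Lb.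
    by rewrite FT mulmxDr !mulmxA UfT -fs mulNmx.
  have -> : U *m F^T *m F^c *m U^t* = (U *m F^T) *m (U *m F^T)^t*.
    by rewrite trmx_mul trmxK map_mxM mulmxA.
  have -> : F^t* *m F = e^t* *m (La *m La^c) *m e + f^t* *m (Lb *m Lb^c) *m f
      + (e^t* *m (Lb *m La^c) *m f + f^t* *m (La *m Lb^c) *m e).
    rewrite -(LC al al) -(LC be be) -(LC al be) -(LC be al).
    rewrite Fs FE mulmxDl !mulmxDr !mulmxA -!addrA; congr (_ + _).
    by rewrite addrA addrC.
  have -> : U *m F^T *m (U *m F^T)^t* =
      f^t* *m (La *m La^c) *m f + e^t* *m (Lb *m Lb^c) *m e
      - (e^t* *m (Lb *m La^c) *m f + f^t* *m (La *m Lb^c) *m e).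
    have -> : (U *m F^T)^t* = La^c *m f - Lb^c *m e.
      by rewrite UFT linearB/= map_mxB !trmx_mul !LT !map_mxM -!map_trmx !trmxK
         !map_mxCK.
    rewrite UFT mulmxBl !mulmxBr !mulmxA opprB -!addrA; congr (_ + _).
    by rewrite opprD addrCA [- _ - _]addrC.
  rewrite addrACA subrr addr0 [X in _ + X]addrC addrACA -!mulmxDl -!mulmxDr.
  by rewrite [_ + La *m _]addrC L1 !mulmx1.
- have := comb 2^-1 (- 'i / 2); congr (_ *m _ *m _ *m _ = _).
  by rewrite AE BE; apply/matrixP=> i j; rewrite !mxE; field: i2.
- have := comb 2^-1 ('i / 2); congr (_ *m _ *m _ *m _ = _).
  by rewrite AE BE; apply/matrixP=> i j; rewrite !mxE; field: i2.
Qed.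

(** * Splitting off the eigenvalue -1 *)

Lemma conjC_eqN1 (C : numClosedFieldType) (d : C) : (d^* == -1) = (d == -1).
Proof. by rewrite -(inj_eq (can_inj (@conjCK C))) conjCK rmorphN rmorph1. Qed.

(** This is the function of [W] that makes [U] symmetric. One of [d] and [d^*] may be chosen freely
    off the real axis; at a real point the relation reads [c d * d = c d], which forces the value 0
    at -1. *)
Lemma unimodular_twist (C : numClosedFieldType) : exists c : C -> C,
  [/\ c (-1) = 0,
      forall d, d * d^* = 1 -> d != -1 -> c d * (c d)^* = 1 &
      forall d, d * d^* = 1 -> c d * d = c d^*].
Proof.
exists (fun d => if d == -1 then 0 else if 0 < 'Im d then d^* else 1).
split=> [|d dd /negPf->|d dd]; first by rewrite eqxx.
  by case: ifP => _; rewrite ?rmorph1 ?mulr1// conjCK mulrC.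
rewrite conjC_eqN1.
have [_|dN1] := eqVneq d (-1); first by rewrite mul0r.
rewrite Im_conj oppr_gt0 conjCK.
have [d_gt0|d_lt0|d_eq0] := real_ltgtP (real0 C) (Creal_Im d).
- by rewrite mulrC dd.
- by rewrite mul1r.
have dr : d^* = d by apply/CrealP/Creal_ImP.
rewrite mul1r; apply/eqP; move: dd; rewrite dr -expr2 => /eqP.
by rewrite sqrf_eq1 (negPf dN1) orbF.
Qed.

(** The coordinates with [d = -1] carry a skew-symmetric compression of [U] and are handled by the
    skew case; on the others [c(W) U] is symmetric and unitary. The direct sum of the two is [V]. *)
Lemma diag_symmetrizable (C : numClosedFieldType) n (T U : 'M[C]_n)
    (d : 'rV[C]_n) :
  (n <= 7)%N -> U \is unitarymx -> T *m U = U *m T^T -> U *m U^c = diag_mx d ->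
  (forall i, d 0 i * (d 0 i)^* = 1) -> symmetrizable T.
Proof.
move=> n7 uU TU UD dd.
have UU := unitarymxP uU.
have cUU : U^c *m U^T = 1%:M by rewrite -[U^T]map_mxCK -map_mxM UU map_mx1.
have cUU' := mulmx1C cUU.
have TD : diag_mx d *m T = T *m diag_mx d.
  rewrite -UD mulmxA TU -!mulmxA; congr (_ *m _).
  rewrite -[RHS]mul1mx -cUU -!mulmxA [U^T *m _]mulmxA -trmx_mul TU.
  by rewrite trmx_mul trmxK -mulmxA cUU' mulmx1.
have UE : U = diag_mx d *m U^T by rewrite -UD -mulmxA cUU mulmx1.
have uE i j : U i j = d 0 i * U j i by rewrite {1}UE mul_diag_mx !mxE.
(* [U] only links an eigenvalue to its conjugate. *)
have du i j : U i j != 0 -> d 0 j = (d 0 i)^*.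
  move=> Uij0; apply: (mulfI (x := d 0 i)).
    by apply: contraNneq Uij0 => di0; rewrite uE di0 mul0r.
  rewrite dd; apply: (mulIf Uij0).
  by rewrite mul1r -mulrA -uE -uE.
have commT (f : C -> C) : diag_mx (map_mx f d) *m T = T *m diag_mx (map_mx f d).
  apply/diag_mx_intertwine=> i j; rewrite ![map_mx _ _ _ _]mxE.
  have [->|T0] := eqVneq (T i j) 0; first by rewrite mulr0 mul0r.
  have /(_ i j) := (diag_mx_intertwine _ _ _).1 TD.
  by rewrite mulrC => /(mulfI T0)->; rewrite mulrC.
(* [X] selects the coordinates where [d] is -1, and [E] is the projection onto them. *)
pose A := [pred i | d 0 i == -1].
pose X : 'M[C]_(#|A|, n) := rowsub (fun k : 'I_#|A| => enum_val k) 1%:M.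
pose E := diag_mx (map_mx (fun z => (z == -1)%:R) d) : 'M[C]_n.
have XXT : X *m X^T = 1%:M.
  rewrite -rowsubE; apply/matrixP=> i j; rewrite !mxE eq_sym.
  by rewrite (inj_eq enum_val_inj).
have XTX : X^T *m X = E.
  apply/matrixP=> i j; rewrite !mxE.
  under eq_bigr do rewrite !mxE.
  rewrite -(big_enum_val (A := A) (fun x => (x == i)%:R * (x == j)%:R : C)).
  have [Ai|nAi] := boolP (i \in A).
    rewrite (bigD1 i)//= eqxx mul1r big1 ?addr0 => [|k /andP[_ /negPf->]].
      by move: Ai; rewrite inE => ->.
    by rewrite mul0r.
  move: (nAi); rewrite inE => /negPf->; rewrite mul0rn big1// => k kA.
  by case: eqP => [ki|_]; [rewrite -ki kA in nAi|rewrite mul0r].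
have Xc : X^c = X by apply/matrixP=> i j; rewrite !mxE conjC_nat.
have Xs : X^t* = X^T by rewrite -map_trmx Xc.
have XE : X *m E = X by rewrite -XTX mulmxA XXT mul1mx.
have EXT : E *m X^T = X^T by rewrite -XTX -mulmxA XXT mulmx1.
have ET : E *m T = T *m E by exact: commT.
have EU : E *m U = U *m E.
  apply/diag_mx_intertwine=> i j; rewrite ![map_mx _ _ _ _]mxE mulrC.
  have [->|/du->] := eqVneq (U i j) 0; first by rewrite !mul0r.
  by rewrite conjC_eqN1.
pose T1 := X *m T *m X^T; pose U1 := X *m U *m X^T.
have XT : X *m T = T1 *m X.
  by rewrite /T1 -mulmxA XTX -mulmxA -ET mulmxA XE.
have TX : T *m X^T = X^T *m T1.
  by rewrite /T1 !mulmxA XTX ET -mulmxA EXT.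
have XU : X *m U = U1 *m X.
  by rewrite /U1 -mulmxA XTX -mulmxA -EU mulmxA XE.
have uU1 : U1 \is unitarymx.
  apply/unitarymxP; rewrite {2}/U1 !conjT Xc Xs !mulmxA -XU.
  by rewrite -[_ *m U *m _]mulmxA UU mulmx1.
(* Where [d] is -1, the relation [UE] becomes skew-symmetry. *)
have sU1 : U1^T = - U1.
  rewrite /U1 !conjT mulmxA -mulNmx; congr (_ *m _).
  rewrite {2}UE mulmxA -mulNmx; congr (_ *m _).
  rewrite mul_mx_diag; apply/matrixP=> i j; rewrite !mxE.
  have [<-|] := eqVneq; last by rewrite mul0r oppr0.
  by have := enum_valP i; rewrite inE => /eqP->; rewrite mul1r opprK.
have TU1 : T1 *m U1 = U1 *m T1^T.
  rewrite /U1 mulmxA [T1 *m _]mulmxA -XT -[X *m T *m U]mulmxA TU.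
  by rewrite -!mulmxA -!trmx_mul XT.
have k7 : (#|A| <= 7)%N by rewrite (leq_trans (max_card _))// card_ord.
have [V1 [uV1 sV1 TV1]] := skew_symmetrizable k7 uU1 sU1 TU1.
have [c [c0 c1 c2]] := unimodular_twist C.
pose D := diag_mx (map_mx c d).
(* Since [c] vanishes at -1, the two summands of the witness live on complementary coordinates. *)
have ED : E *m D = 0.
  rewrite mulmx_diag; apply/matrixP=> i j; rewrite !mxE.
  by case: eqP => [->|_]; rewrite ?c0 ?mulr0 ?mul0r mul0rn.
have DE : D *m E = 0 by rewrite /D diag_mxC.
have EcD : E *m D^t* = 0.
  rewrite tr_diag_mx map_diag_mx mulmx_diag; apply/matrixP=> i j; rewrite !mxE.
  by case: eqP => [->|_]; rewrite ?c0 ?rmorph0 ?mulr0 ?mul0r mul0rn.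
exists (X^T *m V1 *m X + D *m U); split.
- apply/unitarymxP; rewrite linearD/= map_mxD !conjT Xc Xs mulmxDl !mulmxDr !mulmxA.
  have XUD : X *m U^t* *m D^t* = 0.
    have EUs : E *m U^t* = U^t* *m E.
      have := congr1 (fun M => M^t*) EU.
      have Es : E^t* = E by rewrite -XTX !conjT Xs Xc.
      by rewrite !conjT Es.
    by rewrite -XE -[X *m E *m _]mulmxA EUs -!mulmxA EcD !mulmx0.
  have DUX : D *m U *m X^T = 0.
    by rewrite -EXT mulmxA -[D *m U *m E]mulmxA -EU mulmxA DE !mul0mx.
  rewrite DUX !mul0mx add0r -[_ *m X *m X^T]mulmxA XXT mulmx1.
  rewrite -[X^T *m V1 *m _]mulmxA (unitarymxP uV1) mulmx1 XTX.
  rewrite -[X^T *m V1 *m X *m _]mulmxA -[X^T *m V1 *m _ *m _]mulmxA XUD mulmx0.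
  rewrite addr0 -[D *m U *m _]mulmxA UU mulmx1 tr_diag_mx map_diag_mx mulmx_diag.
  apply/matrixP=> i j; rewrite !mxE -mulrnDl.
  by case: eqP => [->|/eqP/(c1 _ (dd i))->]; rewrite ?c0 ?mul0r ?addr0 ?add0r.
- rewrite linearD/= !conjT sV1 mulmxA tr_diag_mx; congr (_ + _).
  rewrite mul_diag_mx mul_mx_diag; apply/matrixP=> i j; rewrite !mxE (uE i j).
  have [->|/du di] := eqVneq (U j i) 0; first by rewrite !mulr0 mul0r.
  by rewrite mulrA c2// di conjCK mulrC.
- rewrite mulmxDr mulmxDl !mulmxA; congr (_ + _).
    rewrite TX -[X^T *m T1 *m V1]mulmxA TV1 -!mulmxA; congr (_ *m (_ *m _)).
    by apply: trmx_inj; rewrite !trmx_mul !trmxK TX.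
  by rewrite -commT -!mulmxA TU.
Qed.

(** * Diagonalizing [U conj(U)] and conclusion *)

(** In an eigenbasis [P] of [U *m U^c], [T] changes by conjugation but [U] by the congruence
    [P U P^T], as befits an antilinear map; this preserves [T U = U T^T] and makes [U *m U^c]
    diagonal. *)
Lemma transpose_symmetrizable (C : numClosedFieldType) n (T : 'M[C]_n) :
  (n <= 7)%N -> unitarily_equivalent T T^T -> symmetrizable T.
Proof.
move=> n7 [U uU TE]; have UU := unitarymxP uU.
have TU : T *m U = U *m T^T by rewrite TE -mulmxA (mulmx1C UU) mulmx1 -TE.
have uW : U *m U^c \is unitarymx by rewrite mul_unitarymx// conjC_unitary.
have [P [d [uP WE dd]]] := unitary_spectral uW.
have PP := unitarymxP uP; have PP' := mulmx1C PP.
have cPP : P^c *m P^T = 1%:M by rewrite -[P^T]map_mxCK -map_mxM PP map_mx1.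
have cPP' := mulmx1C cPP.
have [] := @diag_symmetrizable _ _ (P *m T *m P^t*) (P *m U *m P^T) d n7.
- by rewrite !mul_unitarymx ?trmx_unitary.
- rewrite !conjT !mulmxA -[_ *m P^t* *m P]mulmxA PP' mulmx1.
  rewrite -[_ *m P^T *m P^c]mulmxA cPP' mulmx1.
  by rewrite -[P *m T *m U]mulmxA TU mulmxA.
- rewrite !conjT !mulmxA -[_ *m P^T *m P^c]mulmxA cPP' mulmx1.
  rewrite -[P *m U *m _]mulmxA WE !mulmxA PP mul1mx -mulmxA PP mulmx1.
  by [].
- by [].
move=> V [uV sV TV]; exists (P^t* *m V *m P^c); split.
- by rewrite !mul_unitarymx ?trmxC_unitary ?conjC_unitary.
- by rewrite !conjT sV mulmxA.
move: TV => /(congr1 (fun M => P^t* *m M *m P^c)).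
rewrite !conjT !mulmxA PP' mul1mx => ->.
by rewrite -[_ *m P^T *m P^c]mulmxA cPP' mulmx1.
Qed.

Local Open Scope complex_scope.

Theorem corollary2p3 (R : realType) (n : nat) (hn : (n <= 7)%N)
    (T : 'M[R[i]]_n) (hT : unitarily_equivalent T T^T) :
  exists2 S : 'M[R[i]]_n, complex_symmetric S & unitarily_equivalent T S.
Proof. exact/symmetrizable_UECSM/transpose_symmetrizable. Qed.
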